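(* Let $m,n,s$ be positive integers, let $n_1,\dots,n_s$ be positive integers with $\sum_{i=1}^s n_i=n$, and let $p>0$. Let $C\in\mathbb{R}^{m\times n}$ be a matrix of rank $r$. If there are distinct indices $i_1,\dots,i_q\in\{1,\dots,s\}$ such that $\sum_{j=1}^{q} n_{i_j}=r$, then $$G_p^{|\cdot|^0}(C)=\operatorname{rank}(C).$$
   Context: For a matrix $Z$ with real entries, $\|Z\|_p=\big(\sum_{i,j}|Z_{ij}|^p\big)^{1/p}$ denotes the entrywise $\ell_p$ (quasi-)norm. Convention: $|t|^0=1$ for $t\neq 0$ and $0^0=0$. Fix positive integers $n_1,\dots,n_s$ with $\sum_i n_i=n$. Matrices $X\in\mathbb{R}^{m\times n}$ and $Y\in\mathbb{R}^{n\times n}$ are partitioned columnwise into consecutive blocks $X=[X_1,\dots,X_s]$, $Y=[Y_1,\dots,Y_s]$ with $X_i\in\mathbb{R}^{m\times n_i}$, $Y_i\in\mathbb{R}^{n\times n_i}$. The flexible group sparse regularizer with the function $|\cdot|^0$ is $$G_p^{|\cdot|^0}(C)=\min_{X\in\mathbb{R}^{m\times n},\,Y\in\mathbb{R}^{n\times n},\;XY^T=C}\ \frac12\sum_{i=1}^s n_i\big(\|X_i\|_p^0+\|Y_i\|_p^0\big).$$ *)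

(* Defs.v *)
From mathcomp Require Import all_boot all_order all_algebra.
From mathcomp Require Import all_classical all_reals all_analysis.

Set Implicit Arguments.
Unset Strict Implicit.
Unset Printing Implicit Defensive.
Import Order.TTheory GRing.Theory Num.Theory.
Local Open Scope classical_set_scope.
Local Open Scope ring_scope.

Definition lpnorm (R : realType) (p : R) (m n : nat) (Z : 'M[R]_(m, n)) : R :=
  (\sum_i \sum_j `|Z i j| `^ p) `^ p^-1.

(* |t|^0 with the convention 0^0 = 0; the library's powR and exponentiation
   both set 0^0 = 1, so neither can be used here. *)
Definition abs0 (R : realType) (t : R) : R := if t == 0 then 0 else 1.

(* The i-th of s consecutive column blocks of Z, of widths n_ 0, ..., n_ (s-1). *)
Definition colblock (R : realType) (m n s : nat) (n_ : 'I_s -> nat)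
    (hn : (\sum_(i < s) n_ i)%N = n) (Z : 'M[R]_(m, n)) (i : 'I_s) :
    'M[R]_(m, n_ i) :=
  submxrow (castmx (erefl m, esym hn) Z) i.

Definition group_cost (R : realType) (p : R) (m n s : nat) (n_ : 'I_s -> nat)
    (hn : (\sum_(i < s) n_ i)%N = n) (X : 'M[R]_(m, n)) (Y : 'M[R]_n) : R :=
  2^-1 * \sum_(i < s) (n_ i)%:R *
    (abs0 (lpnorm p (colblock hn X i)) + abs0 (lpnorm p (colblock hn Y i))).

Definition is_min (R : realType) (A : set R) (v : R) : Prop :=
  A v /\ lbound A v.

Definition factor_costs (R : realType) (p : R) (m n s : nat)
    (n_ : 'I_s -> nat) (hn : (\sum_(i < s) n_ i)%N = n) (C : 'M[R]_(m, n)) :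
    set R :=
  [set v | exists (X : 'M[R]_(m, n)) (Y : 'M[R]_n),
     X *m Y^T = C /\ v = group_cost p hn X Y].

(* The default value 0 of [xget] is never used: the minimum always exists, by
   [flexG_is_min]. *)
Definition flexG (R : realType) (p : R) (m n s : nat) (n_ : 'I_s -> nat)
    (hn : (\sum_(i < s) n_ i)%N = n) (C : 'M[R]_(m, n)) : R :=
  xget 0 [set v | is_min (factor_costs p hn C) v].

Lemma flexG_is_min (R : realType) (p : R) (m n s : nat) (n_ : 'I_s -> nat)
    (hn : (\sum_(i < s) n_ i)%N = n) (C : 'M[R]_(m, n)) :
  is_min (factor_costs p hn C) (flexG p hn C).
Proof.
have costE (X : 'M[R]_(m, n)) (Y : 'M[R]_n) :
    exists k : nat, group_cost p hn X Y = 2^-1 * k%:R.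
  exists (\sum_(i < s) n_ i * ((lpnorm p (colblock hn X i) != 0%R) +
                               (lpnorm p (colblock hn Y i) != 0%R)))%N.
  rewrite /group_cost natr_sum; congr (_ * _); apply: eq_bigr => i _.
  by rewrite natrM natrD /abs0; do 2 case: ifP.
pose P k := `[< factor_costs p hn C (2^-1 * k%:R) >].
have exP : exists k, P k.
  have [k Hk] := costE C 1%:M.
  exists k; apply/asboolP; exists C, 1%:M; split=> //.
  by rewrite trmx1 mulmx1.
apply: (@xgetPex _ 0 [set v | is_min (factor_costs p hn C) v]).
case: (ex_minnP exP) => k /asboolP Pk kmin.
exists (2^-1 * k%:R); split=> // _ [X [Y [XY ->]]].
have [l Hl] := costE X Y; rewrite Hl ler_pM2l ?invr_gt0 ?ltr0n// ler_nat.
by apply: kmin; apply/asboolP; exists X, Y.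
Qed.

(* Main.v *)
Require Import Defs.
From mathcomp Require Import all_boot all_order all_algebra.
From mathcomp Require Import all_classical all_reals all_analysis.
Import Order.TTheory GRing.Theory Num.Theory.
Local Open Scope ring_scope.

(** The product [X *m Y^T] is the sum of the [X_i *m Y_i^T], and such a term has
    rank at most [n_i] and vanishes unless both [X_i] and [Y_i] are nonzero, so
    every cost is at least [\rank C]. For equality, let [D] be the diagonal
    projection onto the selected blocks: it has the rank of [C], hence
    [C = U *m D *m V], and as [D] is idempotent [X = U *m D], [Y^T = D *m V]
    is a factorization supported on the selected blocks only. *)

(** Since [0 < p], the powers vanish exactly at zero entries; they are nonnegative, so a zero sum
    has only zero terms. Consequently the cost depends only on which blocks are nonzero. *)
Lemma lpnorm_eq0 {R : realType} {p : R} {m n : nat} (Z : 'M[R]_(m, n)) :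
  0 < p -> (lpnorm p Z == 0) = (Z == 0).
Proof.
move=> p0; have pN0 := lt0r_neq0 p0.
rewrite powR_eq0 invr_eq0 pN0 andbT; apply/eqP/eqP => [Z0|->]; last first.
  by do 2 (apply: big1 => ? _); rewrite mxE normr0 powR0.
apply/matrixP => i j; rewrite mxE; apply/normr0_eq0/(@powR_eq0_eq0 _ _ p).
have Zi0 : \sum_j `|Z i j| `^ p = 0.
  by apply: (psumr_eq0P _ Z0) => // k _; apply: sumr_ge0 => l _; exact: powR_ge0.
by apply: (psumr_eq0P _ Zi0) => // l _; exact: powR_ge0.
Qed.

Lemma abs0_lpnorm {R : realType} {p : R} {m n : nat} (Z : 'M[R]_(m, n)) :
  0 < p -> abs0 (lpnorm p Z) = (Z != 0)%:R.
Proof. by move=> p0; rewrite /abs0 lpnorm_eq0//; case: eqP. Qed.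

Lemma group_costE {R : realType} {p : R} {m n s : nat} {n_ : 'I_s -> nat}
    (hn : (\sum_(i < s) n_ i)%N = n) (X : 'M[R]_(m, n)) (Y : 'M[R]_n) :
    0 < p ->
  group_cost p hn X Y = 2^-1 *
    \sum_(i < s) (n_ i)%:R *
      ((colblock hn X i != 0)%:R + (colblock hn Y i != 0)%:R).
Proof.
move=> p0; rewrite /group_cost; congr (_ * _).
by apply: eq_bigr => i _; rewrite !abs0_lpnorm.
Qed.

Lemma mulmx_colblock {R : realType} {m k n s : nat} {n_ : 'I_s -> nat}
    (hn : (\sum_(i < s) n_ i)%N = n) (X : 'M[R]_(m, n)) (Y : 'M[R]_(k, n)) :
  X *m Y^T = \sum_(i < s) colblock hn X i *m (colblock hn Y i)^T.
Proof.
(* Destructing [hn] turns [n] into the sum of the widths, and the cast in [colblock] becomes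
   trivial. *)
rewrite /colblock; case: n / hn X Y => X Y; rewrite !castmx_id.
by rewrite -mul_mxrow_mxcol -tr_mxrow !submxrowK.
Qed.

Lemma rank_le_group_cost {R : realType} {p : R} {m n s : nat} {n_ : 'I_s -> nat}
    (hn : (\sum_(i < s) n_ i)%N = n) (X : 'M[R]_(m, n)) (Y : 'M[R]_n) :
  0 < p -> (\rank (X *m Y^T))%:R <= group_cost p hn X Y.
Proof.
move=> p0; rewrite group_costE// (mulmx_colblock hn).
set XY := fun i => colblock hn X i *m (colblock hn Y i)^T.
apply: (@le_trans _ _ (\sum_i (\rank (XY i))%:R)).
  rewrite -natr_sum ler_nat.
  elim/big_rec2: _ => [|i r A _ le_r]; first by rewrite mxrank0.
  by rewrite (leq_trans (mxrank_add _ _))// leq_add2l.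
rewrite mulr_sumr; apply: ler_sum => i _.
rewrite mulrCA; have [X0|_] := eqVneq (colblock hn X i) 0.
  by rewrite /XY X0 mul0mx mxrank0 !mulr_ge0 ?addr_ge0.
have [Y0|_] := eqVneq (colblock hn Y i) 0.
  by rewrite /XY Y0 trmx0 mulmx0 mxrank0 !mulr_ge0 ?addr_ge0.
(* Both blocks are nonzero, so the two indicators add up to 2 and cancel [2^-1]; what remains is to
   bound the rank by the width [n_ i]. *)
rewrite -(natrD _ 1 1) mulVf ?pnatr_eq0// mulr1 ler_nat.
by rewrite (leq_trans (mxrankM_maxl _ _))// rank_leq_col.
Qed.

(** In the bases that bring both matrices to the form [pid_mx], [A] arises from [D] by dropping the
    diagonal ones beyond [\rank A]; [U] and [V] combine this truncation with the changes of
    basis. *)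
Lemma mulmx_factor_rank {F : fieldType} {m n k l : nat}
    (A : 'M[F]_(m, n)) (D : 'M[F]_(k, l)) :
  (\rank A <= \rank D)%N ->
  exists (U : 'M[F]_(m, k)) (V : 'M[F]_(l, n)), A = U *m D *m V.
Proof.
move=> leAD.
exists (col_ebase A *m pid_mx (\rank A) *m invmx (col_ebase D)).
exists (invmx (row_ebase D) *m pid_mx (\rank A) *m row_ebase A).
rewrite -[X in _ *m X *m _]mulmx_ebase !mulmxA.
rewrite mulmxKV ?col_ebase_unit// mulmxK ?row_ebase_unit//.
(* The bases of [D] have cancelled; the three partial identities multiply to the one of smallest
   rank, [\rank A]. *)
rewrite -!(mulmxA (col_ebase A)) !mul_pid_mx.
have rAk := leq_trans leAD (rank_leq_row D).
have rAl := leq_trans leAD (rank_leq_col D).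
rewrite (minn_idPl leAD) (minn_idPr rAk) minnn (minn_idPr rAl).
by rewrite mulmxA mulmx_ebase.
Qed.

Lemma group_cost_le_rank {R : realType} {p : R} {m n s : nat} {n_ : 'I_s -> nat}
    (hn : (\sum_(i < s) n_ i)%N = n) (C : 'M[R]_(m, n)) (S : {set 'I_s}) :
    0 < p -> (\rank C <= \sum_(i in S) n_ i)%N ->
  exists (X : 'M[R]_(m, n)) (Y : 'M[R]_n),
    X *m Y^T = C /\ group_cost p hn X Y <= (\sum_(i in S) n_ i)%:R.
Proof.
move=> p0; case: n / hn C => C leC.
pose d : 'rV[R]__ := \mxrow_i (const_mx (i \in S)%:R : 'rV_(n_ i)).
pose D := diag_mx d.
(* The block form yields the rank of [D] and the column blocks of [Z *m D]; the form [diag_mx]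
   yields idempotence and symmetry. *)
have DE : D = \mxdiag_i (i \in S)%:R%:M.
  by rewrite /D diag_mxrow; apply: eq_mxdiag => i; rewrite diag_const_mx.
have [|U [V CE]] := mulmx_factor_rank C D.
  rewrite (leq_trans leC)// DE rank_mxdiag big_mkcond leq_sum// => i _.
  by case: (i \in S); rewrite ?mxrank1.
have DD : D *m D = D.
  rewrite mulmx_diag; congr diag_mx; apply/rowP => j.
  by rewrite !mxE -natrM mulnb andbb.
have blockD k (Z : 'M[R]_(k, _)) i : i \notin S ->
    colblock erefl (Z *m D) i = 0.
  move=> /negbTE iS; rewrite /colblock castmx_id DE -[Z]submxrowK.
  by rewrite mul_mxrow_mxdiag mxrowK iS raddf0 mulmx0.
exists (U *m D), (V^T *m D); split.
  by rewrite trmx_mul trmxK tr_diag_mx mulmxA -(mulmxA U) DD.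
rewrite group_costE// natr_sum mulr_sumr [leRHS]big_mkcond ler_sum// => i _.
have [iS|iS] := boolP (i \in S); last by rewrite !blockD ?eqxx ?addr0 ?mulr0.
(* A selected block costs at most its width, since half the sum of two indicators is at most 1. *)
rewrite mulrCA ler_piMr// mulrC ler_pdivrMr// mul1r.
by rewrite -natrD ler_nat; do 2 case: (_ == _).
Qed.

Theorem theorem2p3 (R : realType) (m n s : nat) (n_ : 'I_s -> nat)
    (hm : (0 < m)%N) (hn : (0 < n)%N) (hs : (0 < s)%N)
    (hn_ : forall i, (0 < n_ i)%N)
    (hsum : (\sum_(i < s) n_ i)%N = n)
    (p : R) (hp : 0 < p)
    (C : 'M[R]_(m, n)) (r : nat) (hr : \rank C = r)
    (hsub : exists (q : nat) (idx : 'I_q -> 'I_s),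
        injective idx /\ (\sum_(j < q) n_ (idx j))%N = r) :
  flexG p hsum C = (\rank C)%:R.
Proof.
have [q [idx [idx_inj sum_idx]]] := hsub.
(* As [idx] is injective, the sum over its image counts each selected width once. *)
have sumS : (\sum_(i in [set idx j | j : 'I_q]) n_ i)%N = \rank C.
  by rewrite hr -sum_idx big_imset//; apply: in2W.
have [[X [Y [XY GE]]] Gle] := flexG_is_min p hsum C.
apply/le_anti/andP; split; last by rewrite GE -XY; exact: rank_le_group_cost.
have [|X' [Y' [XY' le_rank]]] := group_cost_le_rank hsum C [set idx j | j : 'I_q] hp.
  by rewrite sumS.
rewrite -sumS; apply: le_trans le_rank.
exact: (Gle _ (ex_intro _ X' (ex_intro _ Y' (conj XY' erefl)))).
Qed.
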